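(* Let $m\in\mathbb{N}$. There is a constant $C_m$, depending only on $m$, such that for all $\lambda\ge 1$ and all $\phi\in\Lambda^1_{(m)}$, $$\Big\|\,I_\lambda(\phi)(y)-\int_0^y\phi(\xi)\,d\xi\,\Big\|_{\Lambda^0_{(m+1)}}\le C_m\,\lambda^{-1/2}\,\|\phi\|_{\Lambda^1_{(m)}},$$ where the norm on the left is that of the function of $y\in\mathbb{R}$.
   Context: Here $\mathbb{N}=\{0,1,2,\dots\}$. For $m,k\in\mathbb{N}$, $\Lambda^k_{(m)}$ is the space of $k$ times continuously differentiable functions $\phi$ on $\mathbb{R}$ for which there is a constant $C$ with $|\partial^l\phi(x)|\le C(1+|x|)^m$ for all $x\in\mathbb{R}$ and $0\le l\le k$; $\|\phi\|_{\Lambda^k_{(m)}}$ is the best such constant $C$. For $\lambda>0$ the operator $I_\lambda$ is $$I_\lambda(\phi)(y)=\mathrm{P.V.}\int_{-\infty}^\infty\frac{1}{e^{\lambda(y-\eta)}-e^{-\lambda(y-\eta)}}\;\frac{e^{-\lambda y}+e^{\lambda y}}{e^{-\lambda\eta}+e^{\lambda\eta}}\;\phi(\eta)\,d\eta,$$ where the principal value means the limit as $\epsilon\to0^+$ of the integral over $|y-\eta|>\epsilon$. *)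

(* Defs.v *)
From HB Require Import structures.
From mathcomp Require Import all_boot all_order all_algebra.
From mathcomp Require Import all_classical all_reals all_analysis.

Set Implicit Arguments.
Unset Strict Implicit.
Unset Printing Implicit Defensive.

Import Order.TTheory GRing.Theory Num.Theory.
Import numFieldNormedType.Exports.

Local Open Scope classical_set_scope.
Local Open Scope ring_scope.

Definition continuously_differentiable (R : realType) (k : nat) (f : R -> R) : Prop :=
  (forall l : nat, (l < k)%N -> forall x : R, derivable (derive1n l f) x 1) /\
  (forall l : nat, (l <= k)%N -> continuous (derive1n l f)).

Definition Lambda_bound (R : realType) (k m : nat) (f : R -> R) (C : R) : Prop :=
  forall l : nat, (l <= k)%N -> forall x : R, `|derive1n l f x| <= C * (1 + `|x|) ^+ m.

Definition Lambda (R : realType) (k m : nat) (f : R -> R) : Prop :=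
  continuously_differentiable k f /\ exists C : R, Lambda_bound k m f C.

(* Meaningful only when [Lambda k m f]: [inf] of the empty set is [0]. *)
Definition Lambda_norm (R : realType) (k m : nat) (f : R -> R) : R :=
  inf [set C : R | Lambda_bound k m f C].

Definition punctured (R : realType) (y eps : R) : set R :=
  [set eta | eps < `|y - eta|].

Definition truncated_integral (R : realType) (f : R -> R) (y eps : R) : R :=
  (\int[lebesgue_measure]_(eta in punctured y eps) f eta)%R.

(* Integrability is required because [Rintegral] is a total operator; likewise
   [PV] below is the principal value only when [PV_exists] holds. *)
Definition PV_exists (R : realType) (f : R -> R) (y : R) : Prop :=
  (forall eps : R, 0 < eps ->
     lebesgue_measure.-integrable (punctured y eps) (EFin \o f)) /\
  cvg (truncated_integral f y eps @[eps --> 0^'+]).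

Definition PV (R : realType) (f : R -> R) (y : R) : R :=
  lim (truncated_integral f y eps @[eps --> 0^'+]).

Definition I_integrand (R : realType) (lambda : R) (phi : R -> R) (y eta : R) : R :=
  1 / (expR (lambda * (y - eta)) - expR (- (lambda * (y - eta)))) *
  ((expR (- (lambda * y)) + expR (lambda * y)) /
   (expR (- (lambda * eta)) + expR (lambda * eta))) *
  phi eta.

Definition I_op (R : realType) (lambda : R) (phi : R -> R) (y : R) : R :=
  PV (I_integrand lambda phi y) y.

Definition oriented_integral (R : realType) (a b : R) (f : R -> R) : R :=
  if a <= b then (\int[lebesgue_measure]_(x in `[a, b]) f x)%R
  else - (\int[lebesgue_measure]_(x in `[b, a]) f x)%R.

(* Main.v *)
(** By the addition formula for cosh, the kernel of [I_lambda] equals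
    [(coth (lambda (y - eta)) + tanh (lambda eta)) / 2].  Subtracting the signs
    of [y - eta] and [eta], whose half-sum is the oriented indicator of the
    interval from [0] to [y], leaves two exponentially decaying kernels:
    [sgn t / (exp (2 lambda |t|) - 1)] at [t = y - eta], and
    [- sgn eta / (exp (2 lambda |eta|) + 1)].  The first is odd in [t], so its
    principal value is an integral against [phi (y - t) - phi (y + t)], which is
    O(|t|) by the mean value theorem; this gives O(1 / lambda).  The second
    integral does not depend on [y] and is O(1 / lambda) as well. *)
Require Import Defs.
From HB Require Import structures.
From mathcomp Require Import all_boot all_order all_algebra.
From mathcomp Require Import all_classical all_reals all_analysis.
From mathcomp Require Import measurable_realfun exponential_distribution.
From mathcomp Require Import ring lra.
Set Implicit Arguments.
Unset Strict Implicit.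
Unset Printing Implicit Defensive.

Import Order.TTheory GRing.Theory Num.Theory.
Import numFieldNormedType.Exports.
Local Open Scope classical_set_scope.
Local Open Scope ring_scope.

(** * Measurability of inversion and of punctured lines *)

Lemma measurable_invr (R : realType) : measurable_fun [set: R] (@GRing.inv R).
Proof.
(* The point [0], where inversion is not continuous, is split off; on a singleton every function is
   measurable. *)
have -> : [set: R] = [set x | x != 0] `|` [set 0].
  apply/seteqP; split=> x // _.
  by have [->|x0] := eqVneq x 0; [right|left].
have o0 : open [set x : R | x != 0] by exact: open_neq.
apply/measurable_funU; [exact: open_measurable|exact: measurable_set1|split].
  apply: open_continuous_measurable_fun => // x; rewrite inE => x0.
  exact: inv_continuous.
exact: measurable_fun_set1.
Qed.

Lemma measurable_punctured (R : realType) (y eps : R) :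
  measurable (punctured y eps : set (measurableTypeR R)).
Proof.
rewrite (_ : punctured y eps = `]-oo, y - eps[%classic `|` `]y + eps, +oo[%classic).
  by apply: measurableU; exact: measurable_itv.
apply/seteqP; split=> x; rewrite /punctured /= !in_itv /= ?andbT ltr_normr opprB.
  by case/orP=> h; [left|right]; lra.
by case=> h; apply/orP; [left|right]; lra.
Qed.

(** * Change of variables under the reflection [t |-> y - t] *)

Section reflection.
Variable R : realType.
Notation mu := (@lebesgue_measure R).
Variable y : R.

Definition reflect_at : measurableTypeR R -> measurableTypeR R := fun t => y - t.

Lemma measurable_reflect_at : measurable_fun setT reflect_at.
Proof. exact: measurable_funB. Qed.

(** Lebesgue measure is determined by its values on half-open intervals; the reflection keeps their
    lengths and only moves the closed end to the other side. *)
Lemma lebesgue_measure_reflect_at (A : set R) : measurable A ->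
  pushforward mu reflect_at A = mu A.
Proof.
move=> mA; apply/esym.
apply: (lebesgue_measure_unique _) => //=; first exact: measurable_reflect_at.
move=> mf _ [[a b]] _ <-.
rewrite /pushforward (_ : reflect_at @^-1` _ = `[y - b, y - a[%classic).
  rewrite !lebesgue_measure_itv/= !lte_fin ltrD2l ltrN2; case: ifP => // _.
  by rewrite -!EFinB; congr EFin; ring.
apply/seteqP; split=> x; rewrite /reflect_at /= !in_itv /=; lra.
Qed.

Variable f : R -> R.
Variable D : set (measurableTypeR R).
Hypothesis mf : measurable_fun setT f.
Hypothesis mD : measurable D.
Hypothesis fD : mu.-integrable (reflect_at @^-1` D) (EFin \o (f \o reflect_at)).

Lemma integrable_reflect_at : mu.-integrable D (EFin \o f).
Proof.
have mEf : measurable_fun setT (EFin \o f) by exact/measurable_EFinP.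
have /integrableP[_ fin] := integrable_pushforward measurable_reflect_at mEf fD mD.
apply/integrableP; split; first exact: measurable_funTS.
apply: le_lt_trans fin; rewrite le_eqVlt; apply/orP; left; apply/eqP.
apply: eq_measure_integral => [|mr A mA _]; first exact: measurable_reflect_at.
exact/esym/lebesgue_measure_reflect_at.
Qed.

Lemma Rintegral_reflect_at :
  \int[mu]_(x in D) f x = \int[mu]_(t in reflect_at @^-1` D) f (y - t).
Proof.
have mEf : measurable_fun setT (EFin \o f) by exact/measurable_EFinP.
have := integral_pushforward measurable_reflect_at mEf fD mD.
rewrite /Rintegral /comp /= => <-; congr fine.
apply: eq_measure_integral => [|mr A mA _]; first exact: measurable_reflect_at.
exact/esym/lebesgue_measure_reflect_at.
Qed.

End reflection.

(** * The kernel split into signs and exponentially decaying remainders *)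

Section kernels.
Variable R : realType.
Implicit Types lam x y t : R.

(* The value [1] at [0] makes [tanh_sgn1] and [I_integrandE] hold at [0] too. *)
Definition sgn1 x : R := if 0 <= x then 1 else -1.

(* [bose lam 0 = 0], because [x / 0 = 0]. *)
Definition bose lam t : R := sgn1 t / (expR (2 * (lam * `|t|)) - 1).

(** [fermi] and [bose] carry the Fermi-Dirac and Bose-Einstein factors 1/(e^u + 1) and 1/(e^u - 1)
    at u = 2 lam |x|, the remainders of tanh and coth relative to the sign. *)
Definition fermi lam x : R := sgn1 x / (expR (2 * (lam * `|x|)) + 1).

(** Since [sgn1 0 = 1], this is 1 on the closed [[0, y]] when [0 <= y], -1 on the open []y, 0[] when
    [y < 0], and 0 elsewhere. *)
Definition oriented_indic y x : R := (sgn1 (y - x) + sgn1 x) / 2.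

Lemma normr_sgn1 x : `|sgn1 x| = 1.
Proof. by rewrite /sgn1; case: ifP => _; rewrite ?normrN normr1. Qed.

Lemma boseN lam t : bose lam (- t) = - bose lam t.
Proof.
have [->|t0] := eqVneq t 0.
  by rewrite oppr0 /bose normr0 mulr0 mulr0 expR0 subrr invr0 mulr0 oppr0.
rewrite /bose normrN -mulNr; congr (_ / _).
rewrite /sgn1 oppr_ge0; case: (ltgtP t 0) t0 => //= _ _; by rewrite opprK.
Qed.

Lemma expR_double x : expR (2 * x) = expR x ^+ 2.
Proof. by rewrite mulrC expRM_natr. Qed.

(** With u = lam t, coth u = sgn u (1 + 2/(e^{2|u|} - 1)). On each side of 0 this is a rational
    identity in a = e^{|u|}, and a > 1 keeps the denominators nonzero. *)
Lemma coth_sgn1 lam t : 0 < lam -> t != 0 ->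
  2 * bose lam t + sgn1 t =
  (expR (lam * t) + expR (- (lam * t))) / (expR (lam * t) - expR (- (lam * t))).
Proof.
move=> lam0 t0; rewrite /bose /sgn1.
have [tp|tn|t00] := ltgtP 0 t; last by rewrite t00 eqxx in t0.
- rewrite ger0_norm ?ltW// expR_double expRN.
  have : 1 < expR (lam * t) by rewrite expR_gt1 mulr_gt0.
  set a := expR _ => a1.
  by field; repeat (apply/andP; split); apply/eqP => h; nra.
- rewrite ltr0_norm// mulrN expR_double.
  have -> : expR (lam * t) = (expR (- (lam * t)))^-1 by rewrite expRN invrK.
  have : 1 < expR (- (lam * t)) by rewrite expR_gt1 oppr_gt0 pmulr_rlt0.
  set a := expR _ => a1.
  by field; repeat (apply/andP; split); apply/eqP => h; nra.
Qed.

Lemma tanh_sgn1 lam x : 0 < lam ->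
  sgn1 x - 2 * fermi lam x =
  (expR (lam * x) - expR (- (lam * x))) / (expR (- (lam * x)) + expR (lam * x)).
Proof.
move=> lam0; rewrite /fermi /sgn1.
have [tp|tn] := leP 0 x.
- rewrite ger0_norm// expR_double expRN.
  have : 0 < expR (lam * x) by exact: expR_gt0.
  set a := expR _ => a1.
  by field; repeat (apply/andP; split); apply/eqP => h; nra.
- rewrite ltr0_norm// mulrN expR_double.
  have -> : expR (lam * x) = (expR (- (lam * x)))^-1 by rewrite expRN invrK.
  have : 0 < expR (- (lam * x)) by exact: expR_gt0.
  set a := expR _ => a1.
  by field; repeat (apply/andP; split); apply/eqP => h; nra.
Qed.

(* The kernel is [(coth (lambda (y - eta)) + tanh (lambda eta)) / 2], by the
   addition formula for [cosh (lambda (y - eta) + lambda eta)]. *)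
Lemma I_integrandE lam (phi : R -> R) y x : 0 < lam -> x != y ->
  I_integrand lam phi y x =
  (bose lam (y - x) - fermi lam x + oriented_indic y x) * phi x.
Proof.
move=> lam0 xy; rewrite /I_integrand; congr (_ * _).
have yx0 : y - x != 0 by rewrite subr_eq0 eq_sym.
have -> : bose lam (y - x) - fermi lam x + oriented_indic y x =
  ((2 * bose lam (y - x) + sgn1 (y - x)) + (sgn1 x - 2 * fermi lam x)) / 2.
  by rewrite /oriented_indic; field.
rewrite coth_sgn1// tanh_sgn1//.
(* Splitting [lam * y] leaves a rational identity in two exponentials; the first differs from 1
   because [x != y]. *)
have -> : lam * y = lam * (y - x) + lam * x by ring.
rewrite opprD !expRD !expRN.
have u1 : expR (lam * (y - x)) != 1.
  by rewrite -expR0 (inj_eq (@expR_inj R)) mulf_neq0// gt_eqF.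
have := expR_gt0 (lam * (y - x)); have := expR_gt0 (lam * x); move: u1.
set a := expR _; set b := expR _ => a1 b0 a0.
field; apply/and4P; split; apply/eqP => h; nra.
Qed.

(** With u = lam |t|, e^{2u} - 1 >= u e^u follows from e^u >= 1 + u. This form keeps both the decay
    and the factor 1/|t| that a difference of values of [phi] will cancel. *)
Lemma normr_bose_le lam t : 0 < lam -> t != 0 ->
  `|bose lam t| <= expR (- (lam * `|t|)) / (lam * `|t|).
Proof.
move=> lam0 t0.
have u0 : 0 < lam * `|t| by rewrite mulr_gt0// normr_gt0.
rewrite /bose normrM normr_sgn1 mul1r; set u := lam * `|t| in u0 *.
have e1 : 1 + u <= expR u by exact: expR_ge1Dx.
rewrite expR_double expRN.
have a0 : 0 < expR u ^+ 2 - 1 by nra.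
have b0 : 0 < expR u * u by rewrite mulr_gt0 ?expR_gt0.
rewrite gtr0_norm ?invr_gt0// -invfM lef_pV2 ?posrE//.
by have : 0 <= expR u * (expR u - (1 + u)) by [rewrite mulr_ge0 ?expR_ge0 ?subr_ge0]; lra.
Qed.

Lemma normr_fermi_le lam x : 0 < lam ->
  `|fermi lam x| <= expR (- (2 * (lam * `|x|))).
Proof.
move=> lam0; rewrite /fermi normrM normr_sgn1 mul1r expRN.
have a0 : 0 < expR (2 * (lam * `|x|)) by exact: expR_gt0.
by rewrite gtr0_norm ?invr_gt0 ?addr_gt0// lef_pV2 ?posrE ?addr_gt0// lerDl.
Qed.

(** Absorbing the polynomial weight costs only e^{x/2}, so a kernel decaying like e^{-x} or faster
    keeps a decay of e^{-x/2}. *)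
Lemma exprD1_le_expR m x : 0 <= x ->
  (1 + x) ^+ m <= (2 * m.+1%:R) ^+ m * expR (x / 2).
Proof.
(* Raising 1 + z <= e^z to the power m yields e^{mz} <= e^{(m+1)z} = e^{x/2}; [m.+1] keeps the
   division legitimate at m = 0. *)
move=> x0; pose z := x / (2 * m.+1%:R).
have m0 : (0 : R) < m.+1%:R by rewrite ltr0n.
have m1 : (1 : R) <= m.+1%:R by rewrite ler1n.
have xz : x = 2 * m.+1%:R * z by rewrite /z; field; rewrite gt_eqF.
have z0 : 0 <= z by rewrite divr_ge0// mulr_ge0// ltW.
have h : 1 + x <= 2 * m.+1%:R * expR z.
  have e1 := expR_ge1Dx z.
  apply: (@le_trans _ _ (2 * m.+1%:R * (1 + z))); last first.
    by rewrite ler_wpM2l ?mulr_ge0// ltW.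
  by rewrite mulrDr mulr1 -xz lerD2r; lra.
apply: (le_trans (lerXn2r m _ _ h)); rewrite ?nnegrE ?addr_ge0// ?mulr_ge0 ?expR_ge0//.
rewrite exprMn ler_wpM2l ?exprn_ge0 ?mulr_ge0//.
rewrite -expRM_natr ler_expR xz.
have -> : 2 * m.+1%:R * z / 2 = z * m.+1%:R by field.
by rewrite ler_wpM2l// ler_nat.
Qed.

Lemma homo_sgn1 : {homo sgn1 : x y / x <= y}.
Proof. by move=> x y xy; rewrite /sgn1; do 2 case: ifPn => ?; lra. Qed.

Lemma measurable_sgn1 : measurable_fun setT sgn1.
Proof. by apply: nondecreasing_measurable => //; exact: homo_sgn1. Qed.

Let measurable_expR2 lam : measurable_fun setT (fun t => expR (2 * (lam * `|t|))).
Proof.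
apply: measurableT_comp; first exact: measurable_expR.
by apply: measurable_funM => //; exact: measurable_funM.
Qed.

Lemma measurable_bose lam : measurable_fun setT (bose lam).
Proof.
apply: measurable_funM; first exact: measurable_sgn1.
apply: (measurableT_comp (@measurable_invr R)).
exact: measurable_funB.
Qed.

Lemma measurable_fermi lam : measurable_fun setT (fermi lam).
Proof.
apply: measurable_funM; first exact: measurable_sgn1.
apply: (measurableT_comp (@measurable_invr R)).
exact: measurable_funD.
Qed.

End kernels.

(** * Integrals of exponentially dominated functions, and shrinking punctures *)

Section integrals.
Variable R : realType.
Notation mu := (@lebesgue_measure R).
Implicit Types (c M y : R) (f : R -> R).

(** A majorant of e^{-c|t|}, equal to it off 0, assembled from two probability densities so that its
    integral 2/c comes from total mass 1. The argument [0 - t] matches [reflect_at 0]. *)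
Let two_sided c : R -> R :=
  fun t => c^-1 * (exponential_pdf c t + exponential_pdf c (0 - t)).

Let expR_le_two_sided c t : 0 < c -> expR (- (c * `|t|)) <= two_sided c t.
Proof.
move=> c0; rewrite /two_sided ler_pdivlMl// sub0r.
have [t0|t0] := leP 0 t.
  rewrite ger0_norm// exponential_pdfE// mulNr lerDl.
  by apply: exponential_pdf_ge0; exact: ltW.
rewrite (@exponential_pdfE _ _ (- t)) ?oppr_ge0 ?(ltW t0)// ltr0_norm// mulNr lerDr.
by apply: exponential_pdf_ge0; exact: ltW.
Qed.

Let integrable_pdf c : 0 < c -> mu.-integrable setT (EFin \o exponential_pdf c).
Proof. exact: integrable_exponential_pdf. Qed.

Let measurable_pdfN c : measurable_fun setT (fun t : R => exponential_pdf c (0 - t)).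
Proof.
apply: (measurableT_comp (@measurable_exponential_pdf _ c)).
exact: measurable_funB.
Qed.

Let pdfNE c : (fun t : R => exponential_pdf c (0 - t)) \o reflect_at 0 =
  exponential_pdf c.
Proof. by apply/funext => t; rewrite /= /reflect_at subKr. Qed.

Let integrable_pdfN c : 0 < c ->
  mu.-integrable setT (EFin \o (fun t : R => exponential_pdf c (0 - t))).
Proof.
move=> c0; apply: (@integrable_reflect_at _ 0) => //.
by rewrite pdfNE; exact: integrable_pdf.
Qed.

Let integrable_pdfD c : 0 < c -> mu.-integrable setT
  (EFin \o (fun t : R => exponential_pdf c t + exponential_pdf c (0 - t))).
Proof.
move=> c0.
exact: (integrableD measurableT (integrable_pdf c0) (integrable_pdfN c0)).
Qed.

Let integrable_two_sided c : 0 < c -> mu.-integrable setT (EFin \o two_sided c).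
Proof.
move=> c0.
exact: (integrableZl measurableT c^-1 (integrable_pdfD c0)).
Qed.

Let Rintegral_two_sided c : 0 < c -> \int[mu]_t two_sided c t = 2 / c.
Proof.
move=> c0; have int1 : \int[mu]_t exponential_pdf c t = 1.
  by rewrite /Rintegral integral_exponential_pdf.
rewrite /two_sided RintegralZl//; last exact: integrable_pdfD.
rewrite RintegralD//; [|exact: integrable_pdf|exact: integrable_pdfN].
rewrite int1 (@Rintegral_reflect_at _ 0 _ setT)//; last first.
  by rewrite pdfNE; exact: integrable_pdf.
rewrite preimage_setT.
under eq_Rintegral do rewrite subKr.
by rewrite int1 mulrC.
Qed.

Lemma integrable_exp_decay c M f : 0 < c -> measurable_fun setT f ->
  (forall t, `|f t| <= M * expR (- (c * `|t|))) -> mu.-integrable setT (EFin \o f).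
Proof.
move=> c0 mf fM.
have M0 : 0 <= M.
  by have := le_trans (normr_ge0 _) (fM 0); rewrite pmulr_lge0// expR_gt0.
apply: (le_integrable measurableT _ _
  (integrableZl measurableT M (integrable_two_sided c0))).
- exact/measurable_EFinP.
- move=> t _ /=; rewrite lee_fin (le_trans (fM t))// (le_trans _ (ler_norm _))//.
  by rewrite ler_wpM2l// expR_le_two_sided.
Qed.

Lemma normr_Rintegral_exp_decay c M f : 0 < c -> measurable_fun setT f ->
  (forall t, `|f t| <= M * expR (- (c * `|t|))) -> `|\int[mu]_t f t| <= M * (2 / c).
Proof.
move=> c0 mf fM.
have intf := integrable_exp_decay c0 mf fM.
have M0 : 0 <= M.
  by have := le_trans (normr_ge0 _) (fM 0); rewrite pmulr_lge0// expR_gt0.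
apply: (le_trans (le_normr_Rintegral _ _)) => //.
rewrite -Rintegral_two_sided// -RintegralZl//; last exact: integrable_two_sided.
apply: le_Rintegral => //.
- exact: integrable_norm.
- exact: (integrableZl measurableT M (integrable_two_sided c0)).
- by move=> t _; rewrite (le_trans (fM t))// ler_wpM2l// expR_le_two_sided.
Qed.

(** Dominated convergence with majorant |f|: the restrictions eventually agree with [f] at every
    point except [y], which is a null set. *)
Lemma cvg_Rintegral_punctured y f : mu.-integrable setT (EFin \o f) ->
  \int[mu]_(x in punctured y eps) f x @[eps --> 0^'+] --> \int[mu]_x f x.
Proof.
(* Dominated convergence concerns sequences, so the right limit at 0 is tested along positive
   sequences tending to 0. *)
move=> intf; apply/cvg_at_rightP => u [u0 cu].
under eq_fun do rewrite Rintegral_mkcond.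
apply: fine_cvg; rewrite /= fineK; last exact: integrable_fin_num.
have mf : measurable_fun setT f by apply/measurable_EFinP; exact: measurable_int intf.
have [] // := @dominated_convergence _ _ _ mu setT measurableT
  (fun n x => ((f \_ (punctured y (u n))) x)%:E) (EFin \o f) (abse \o (EFin \o f)).
- move=> n; apply/measurable_EFinP.
  apply/measurable_restrict => //; first exact: measurable_punctured.
  exact: measurable_funTS.
- exact/measurable_EFinP.
- exists [set y]; split; [exact: measurable_set1|exact: lebesgue_measure_set1|].
  move=> x /= /not_implyP[_ xN]; apply: contrapT => xy; apply: xN.
  apply: cvg_near_cst.
  have xy0 : 0 < `|y - x| by rewrite normr_gt0 subr_eq0; apply/eqP => e; apply: xy.
  move/cvgrPdist_lt : cu => /(_ _ xy0); apply: filterS => n.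
  rewrite sub0r normrN gtr0_norm// => h.
  by rewrite patchE ifT// inE.
- exact: integrable_abse.
- apply: aeW => x n _ /=; rewrite lee_fin patchE; case: ifP => // _.
  by rewrite normr0.
Qed.

End integrals.

(** * The oriented indicator and the integral from 0 to y *)

Section oriented.
Variable R : realType.
Notation mu := (@lebesgue_measure R).
Variable phi : R -> R.
Hypothesis cphi : continuous phi.

Let integrable_itv (a b : R) : mu.-integrable `[a, b] (EFin \o phi).
Proof.
apply: continuous_compact_integrable; first exact: segment_compact.
exact: continuous_subspaceT.
Qed.

Let oriented_indicM_pos (y : R) : 0 <= y ->
  (fun x => oriented_indic y x * phi x) = phi \_ `[0, y].
Proof.
move=> y0; apply/funext => x; rewrite patchE /oriented_indic /sgn1 subr_ge0.
rewrite mem_setE in_itv /= -[point]/(0 : R).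
case: (leP x y); case: (leP 0 x) => /= ? ?; (try by exfalso; lra); by field.
Qed.

Let oriented_indicM_neg (y : R) : y < 0 ->
  (fun x => oriented_indic y x * phi x) = (fun x => -1 * (phi \_ `]y, 0[) x).
Proof.
move=> y0; apply/funext => x; rewrite patchE /oriented_indic /sgn1 subr_ge0.
rewrite mem_setE in_itv /= -[point]/(0 : R).
case: (leP x y); case: (leP 0 x) => /= ? ?; (try by exfalso; lra); by field.
Qed.

Let integrable_oo (a b : R) : mu.-integrable `]a, b[ (EFin \o phi).
Proof.
by apply: (integrableS _ _ _ (integrable_itv a b)) => //; exact: subset_itv_oo_cc.
Qed.

Let integrable_restr (D : set (measurableTypeR R)) : measurable D -> mu.-integrable D (EFin \o phi) ->
  mu.-integrable setT (EFin \o (phi \_ D)).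
Proof.
move=> mD iD; rewrite -restrict_EFin.
exact: (proj1 (@integrable_mkcond _ _ _ mu D (EFin \o phi) mD) iD).
Qed.

Lemma integrable_oriented_indic (y : R) :
  mu.-integrable setT (EFin \o (fun x => oriented_indic y x * phi x)).
Proof.
have [y0|y0] := leP 0 y.
  by rewrite oriented_indicM_pos//; exact: integrable_restr.
rewrite oriented_indicM_neg//.
exact: (integrableZl measurableT (-1) (integrable_restr _ (integrable_oo y 0))).
Qed.

Lemma Rintegral_oriented_indic (y : R) :
  \int[mu]_x (oriented_indic y x * phi x) = oriented_integral 0 y phi.
Proof.
rewrite /oriented_integral; case: ifPn => [y0|]; last rewrite -ltNge => y0.
  by rewrite oriented_indicM_pos// -Rintegral_mkcond.
rewrite oriented_indicM_neg// RintegralZl//; last exact: integrable_restr.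
(* The indicator produces the open interval and [oriented_integral] the closed one; the two
   endpoints are added one at a time. *)
rewrite -Rintegral_mkcond mulN1r Rintegral_itv_bndo_bndc//.
rewrite Rintegral_itv_obnd_cbnd//.
by apply: (integrableS _ _ _ (integrable_itv y 0)) => //; exact: subset_itv_oc_cc.
Qed.

End oriented.

(** * The error term: pointwise estimates, principal value, continuity and bound *)

Section estimate.
Variable R : realType.
Notation mu := (@lebesgue_measure R).
Variables (m : nat) (lam N : R) (phi : R -> R).
Hypothesis lam1 : 1 <= lam.
Hypothesis cphi : continuous phi.
Hypothesis dphi : forall x : R, derivable phi x 1.
Hypothesis phiN : forall x, `|phi x| <= N * (1 + `|x|) ^+ m.
Hypothesis dphiN : forall x, `|derive1 phi x| <= N * (1 + `|x|) ^+ m.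

Let lam0 : 0 < lam. Proof. exact: lt_le_trans lam1. Qed.

Let N0 : 0 <= N.
Proof.
have := le_trans (normr_ge0 _) (phiN 0).
by rewrite normr0 addr0 expr1n mulr1.
Qed.

(** The constant of [exprD1_le_expR]; it depends on [m] alone. *)
Let K : R := (2 * m.+1%:R) ^+ m.

Let K0 : 0 <= K. Proof. by rewrite exprn_ge0 ?mulr_ge0. Qed.

(** The inequality 1 + a + b <= (1 + a)(1 + b) separates the weight in [y] from the growth in [t],
    which the kernels absorb. *)
Let growth (y t : R) : (1 + (`|y| + `|t|)) ^+ m <=
  (1 + `|y|) ^+ m * (K * expR (`|t| / 2)).
Proof.
have y0 := normr_ge0 y; have t0 := normr_ge0 t.
apply: (@le_trans _ _ (((1 + `|y|) * (1 + `|t|)) ^+ m)).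
  by rewrite lerXn2r ?nnegrE; nra.
rewrite exprMn ler_wpM2l ?exprn_ge0 ?addr_ge0//.
exact: exprD1_le_expR.
Qed.

Let weight_le (x y t : R) : `|x| <= `|y| + `|t| ->
  N * (1 + `|x|) ^+ m <= N * ((1 + `|y|) ^+ m * (K * expR (`|t| / 2))).
Proof.
move=> xyt; rewrite ler_wpM2l// (le_trans _ (growth y t))//.
by rewrite lerXn2r ?nnegrE ?lerD2l ?addr_ge0.
Qed.

Let phi_shift_le (y t : R) :
  `|phi (y - t)| <= N * ((1 + `|y|) ^+ m * (K * expR (`|t| / 2))).
Proof. by apply: (le_trans (phiN _)); rewrite weight_le// ler_normB. Qed.

(** Mean value theorem on [y - |t|, y + |t|], whose points have absolute value at most |y| + |t|;
    its length 2|t| is what tames the singularity of [bose]. *)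
Let phi_diff_le (y t : R) : `|phi (y - t) - phi (y + t)| <=
  N * ((1 + `|y|) ^+ m * (K * expR (`|t| / 2))) * (2 * `|t|).
Proof.
have -> : `|phi (y - t) - phi (y + t)| = `|phi (y + `|t|) - phi (y - `|t|)|.
  have [t0|t0] := leP 0 t; first by rewrite (ger0_norm t0) distrC.
  by rewrite (ltr0_norm t0) opprK.
have [|||c cyt ->] := @MVT_segment R phi (derive1 phi) (y - `|t|) (y + `|t|).
- by have := normr_ge0 t; lra.
- by move=> x _; rewrite derive1E; exact: derivableP.
- exact: continuous_subspaceT.
rewrite normrM; have -> : y + `|t| - (y - `|t|) = 2 * `|t| by ring.
rewrite (@ger0_norm _ (2 * _)) ?mulr_ge0// ler_wpM2r ?mulr_ge0//.
apply: (le_trans (dphiN c)); apply: weight_le.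
move: cyt; rewrite in_itv /= => /andP[c1 c2].
by rewrite ler_norml; have := ler_norm y; have := ler_norm (- y); rewrite normrN; lra.
Qed.

(** As [bose] is odd, this is the sum of the values of [bose lam t * phi (y - t)] at [t] and at
    [- t]. *)
Definition sym_integrand (y t : R) : R := bose lam t * (phi (y - t) - phi (y + t)).

Lemma normr_sym_integrand_le (y t : R) : `|sym_integrand y t| <=
  2 * N * K / lam * (1 + `|y|) ^+ m * expR (- (2^-1 * `|t|)).
Proof.
rewrite /sym_integrand normrM.
have [->|t0] := eqVneq t 0.
  rewrite subr0 addr0 subrr normr0 mulr0.
  by rewrite !mulr_ge0 ?invr_ge0 ?expR_ge0 ?exprn_ge0 ?addr_ge0 ?(ltW lam0).
apply: (le_trans (ler_pM (normr_ge0 _) (normr_ge0 _) (normr_bose_le lam0 t0)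
  (phi_diff_le y t))).
have t00 : 0 < `|t| by rewrite normr_gt0.
(* The factor 1/(lam |t|) from [bose] cancels 2|t|, leaving 2/lam. *)
have -> : expR (- (lam * `|t|)) / (lam * `|t|) *
   (N * ((1 + `|y|) ^+ m * (K * expR (`|t| / 2))) * (2 * `|t|)) =
   2 * N * K / lam * (1 + `|y|) ^+ m *
   (expR (- (lam * `|t|)) * expR (`|t| / 2)).
  by field; rewrite !gt_eqF.
rewrite ler_wpM2l//.
  by rewrite !mulr_ge0 ?invr_ge0 ?expR_ge0 ?exprn_ge0 ?addr_ge0 ?(ltW lam0).
rewrite -expRD ler_expR.
(* Here [1 <= lam] enters: the remaining decay rate lam - 1/2 is at least 1/2. *)
by have : 0 <= (lam - 1) * `|t| by [rewrite mulr_ge0 ?subr_ge0]; lra.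
Qed.

(** The rate lam is kept, by 2 lam - 1/2 >= lam, because integrating e^{-lam|x|} is what produces
    the factor 1/lam. *)
Lemma normr_fermiM_le (x : R) :
  `|fermi lam x * phi x| <= N * K * expR (- (lam * `|x|)).
Proof.
have px : `|phi x| <= N * (K * expR (`|x| / 2)).
  by have := phi_shift_le 0 (- x); rewrite opprK add0r normr0 addr0 expr1n mul1r normrN.
rewrite normrM; apply: (le_trans (ler_pM (normr_ge0 _) (normr_ge0 _)
  (normr_fermi_le x lam0) px)).
rewrite (_ : _ * (N * _) = N * K * (expR (- (2 * (lam * `|x|))) * expR (`|x| / 2))); last by ring.
rewrite ler_wpM2l ?mulr_ge0// -expRD ler_expR.
by have : 0 <= (lam - 1) * `|x| by [rewrite mulr_ge0 ?subr_ge0]; have := normr_ge0 x; lra.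
Qed.

Let mphi : measurable_fun setT phi.
Proof. exact: continuous_measurable_fun. Qed.

Let mphiB (y : R) : measurable_fun setT (fun t : R => phi (y - t)).
Proof. by apply: (measurableT_comp mphi); exact: measurable_funB. Qed.

Let mphiD (y : R) : measurable_fun setT (fun t : R => phi (y + t)).
Proof. by apply: (measurableT_comp mphi); exact: measurable_funD. Qed.

Let mbose := measurable_bose lam.

Lemma measurable_sym_integrand (y : R) : measurable_fun setT (sym_integrand y).
Proof. by apply: measurable_funM => //; exact: measurable_funB. Qed.

Lemma integrable_sym_integrand (y : R) :
  mu.-integrable setT (EFin \o sym_integrand y).
Proof.
apply: (@integrable_exp_decay _ 2^-1) => //; first exact: measurable_sym_integrand.
exact: normr_sym_integrand_le.
Qed.

Let mfermiM : measurable_fun setT (fun x : R => fermi lam x * phi x).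
Proof. by apply: measurable_funM => //; exact: measurable_fermi. Qed.

Lemma integrable_fermiM : mu.-integrable setT (EFin \o (fun x : R => fermi lam x * phi x)).
Proof. exact: (integrable_exp_decay lam0 mfermiM normr_fermiM_le). Qed.

(** Away from 0, 1/(lam |t|) <= 1/(lam eps), and the exponential beats the growth. A generic [psi]
    serves both [phi (y - t)] and [phi (y + t)]. *)
Let integrable_boseM (psi : R -> R) (y eps : R) : 0 < eps ->
  measurable_fun setT psi ->
  (forall t, `|psi t| <= N * ((1 + `|y|) ^+ m * (K * expR (`|t| / 2)))) ->
  mu.-integrable (punctured 0 eps) (EFin \o (fun t : R => bose lam t * psi t)).
Proof.
move=> eps0 mpsi psiN; have mP := @measurable_punctured R 0 eps.
apply/(proj2 (@integrable_mkcond _ _ _ mu _ _ mP)).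
rewrite restrict_EFin.
apply: (@integrable_exp_decay _ 2^-1
  ((lam * eps)^-1 * (N * ((1 + `|y|) ^+ m * K)))) => //.
  apply/measurable_restrict => //; apply: measurable_funTS.
  exact: measurable_funM.
have M0 : 0 <= (lam * eps)^-1 * (N * ((1 + `|y|) ^+ m * K)).
  by rewrite mulr_ge0 ?invr_ge0 ?mulr_ge0 ?exprn_ge0 ?addr_ge0// ltW.
move=> t; rewrite patchE; case: ifPn => [|_]; last first.
  by rewrite normr0 mulr_ge0 ?expR_ge0.
rewrite inE /punctured /= sub0r normrN => ept.
have t00 : 0 < `|t| by exact: lt_trans ept.
have t0 : t != 0 by rewrite -normr_gt0.
rewrite normrM; apply: (le_trans (ler_pM (normr_ge0 _) (normr_ge0 _)
  (normr_bose_le lam0 t0) (psiN t))).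
apply: (@le_trans _ _ (expR (- (lam * `|t|)) / (lam * eps) *
  (N * ((1 + `|y|) ^+ m * (K * expR (`|t| / 2)))))).
  rewrite ler_wpM2r ?mulr_ge0 ?exprn_ge0 ?addr_ge0 ?expR_ge0//.
  rewrite ler_wpM2l ?expR_ge0// lef_pV2 ?posrE ?mulr_gt0//.
  by rewrite ler_wpM2l ?ltW.
rewrite (_ : _ * (N * _) = (lam * eps)^-1 * (N * ((1 + `|y|) ^+ m * K)) *
  (expR (- (lam * `|t|)) * expR (`|t| / 2))); last by ring.
rewrite ler_wpM2l// -expRD ler_expR.
by have : 0 <= (lam - 1) * `|t| by [rewrite mulr_ge0 ?subr_ge0]; lra.
Qed.

Let reflect_at_punctured (y z eps : R) :
  reflect_at y @^-1` punctured z eps = punctured (y - z) eps.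
Proof.
apply/seteqP; split=> t; rewrite /punctured /reflect_at /=;
  by rewrite -(normrN (z - _)) (_ : - (z - (y - t)) = y - z - t)//; ring.
Qed.

Let integrable_f1 (y eps : R) : 0 < eps ->
  mu.-integrable (punctured 0 eps) (EFin \o (fun t : R => bose lam t * phi (y - t))).
Proof. by move=> eps0; apply: integrable_boseM. Qed.

Let integrable_f2 (y eps : R) : 0 < eps ->
  mu.-integrable (punctured 0 eps) (EFin \o (fun t : R => bose lam t * phi (y + t))).
Proof.
move=> eps0; apply: (@integrable_boseM _ y) => // t.
by have := phi_shift_le y (- t); rewrite opprK normrN.
Qed.

Let singular (y x : R) : R := bose lam (y - x) * phi x.

Let measurable_singular (y : R) : measurable_fun setT (singular y).
Proof.
apply: measurable_funM => //; apply: (measurableT_comp mbose).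
exact: measurable_funB.
Qed.

Let singular_reflect (y : R) :
  singular y \o reflect_at y = (fun t : R => bose lam t * phi (y - t)).
Proof. by apply/funext => t; rewrite /singular /= /reflect_at subKr. Qed.

Let integrable_singular (y eps : R) : 0 < eps ->
  mu.-integrable (punctured y eps) (EFin \o singular y).
Proof.
move=> eps0; apply: (@integrable_reflect_at _ y) => //.
  exact: measurable_punctured.
by rewrite reflect_at_punctured subrr singular_reflect; exact: integrable_f1.
Qed.

(* The reflection [t |-> - t] turns the integral of [bose t * phi (y - t)] into
   minus that of [bose t * phi (y + t)], so both equal half the integral of the
   symmetrised integrand, which is no longer singular at [0]. *)
Let Rintegral_singular (y eps : R) : 0 < eps ->
  \int[mu]_(x in punctured y eps) singular y x =
  2^-1 * \int[mu]_(t in punctured 0 eps) sym_integrand y t.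
Proof.
move=> eps0; have mP := @measurable_punctured R.
have i1 := integrable_f1 y eps0; have i2 := integrable_f2 y eps0.
rewrite (@Rintegral_reflect_at _ y) //; last first.
  by rewrite reflect_at_punctured subrr singular_reflect.
rewrite reflect_at_punctured subrr.
under eq_Rintegral do rewrite /singular subKr.
have e : \int[mu]_(t in punctured 0 eps) (bose lam t * phi (y - t)) =
   - \int[mu]_(t in punctured 0 eps) (bose lam t * phi (y + t)).
  have mi2 : mu.-integrable (punctured 0 eps)
      (EFin \o (fun t : R => - 1 * (bose lam t * phi (y + t)))).
    exact: (integrableZl (mP 0 eps) (-1) i2).
  rewrite (@Rintegral_reflect_at _ 0) //; last 2 first.
  - exact: measurable_funM.
  - rewrite reflect_at_punctured subrr.
    rewrite (_ : _ \o reflect_at 0 = (fun t : R => -1 * (bose lam t * phi (y + t)))) //.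
    by apply/funext => t; rewrite /= /reflect_at sub0r boseN opprK mulN1r mulNr.
  rewrite reflect_at_punctured subrr.
  under eq_Rintegral do rewrite sub0r boseN opprK mulNr -mulN1r.
  by rewrite RintegralZl// mulN1r.
rewrite (_ : \int[mu]_(t in _) sym_integrand y t =
  \int[mu]_(t in punctured 0 eps) (bose lam t * phi (y - t)) -
  \int[mu]_(t in punctured 0 eps) (bose lam t * phi (y + t))).
  by rewrite e; field.
rewrite -RintegralB//.
by apply: eq_Rintegral => t _; rewrite /sym_integrand mulrBr.
Qed.

Let punctured_neq (y eps x : R) : 0 < eps -> x \in punctured y eps -> x != y.
Proof.
move=> eps0; rewrite inE /punctured /= => h.
by rewrite eq_sym -subr_eq0 -normr_gt0 (lt_trans eps0).
Qed.

Let integrable_punctured (f : R -> R) (y eps : R) : mu.-integrable setT (EFin \o f) ->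
  mu.-integrable (punctured y eps) (EFin \o f).
Proof. by apply: integrableS => //; exact: measurable_punctured. Qed.

Let i_fermi y eps := @integrable_punctured _ y eps integrable_fermiM.
Let i_orient y eps := @integrable_punctured _ y eps (integrable_oriented_indic cphi y).

Let integrable_decomp (y eps : R) : 0 < eps ->
  mu.-integrable (punctured y eps)
    (EFin \o (fun x => singular y x - fermi lam x * phi x)).
Proof.
move=> eps0.
exact: (integrableB (@measurable_punctured R y eps) (integrable_singular y eps0)
  (i_fermi y eps)).
Qed.

Let I_integrand_decomp (y eps : R) : 0 < eps ->
  {in punctured y eps, I_integrand lam phi y =1 (fun x =>
  singular y x - fermi lam x * phi x + oriented_indic y x * phi x)}.
Proof.
move=> eps0 x /(punctured_neq eps0) xy.
by rewrite I_integrandE// mulrDl mulrBl.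
Qed.

Lemma integrable_I_integrand (y eps : R) : 0 < eps ->
  mu.-integrable (punctured y eps) (EFin \o I_integrand lam phi y).
Proof.
move=> eps0; have mP := @measurable_punctured R y eps.
apply: (eq_integrable _ _ _ _ (integrableD mP (integrable_decomp y eps0) (i_orient y eps))) => //.
by move=> x xP /=; rewrite (I_integrand_decomp eps0).
Qed.

(** Away from [y] the three pieces are integrable separately, so the symmetrisation applies to the
    singular one alone, before [eps] tends to 0. *)
Lemma truncated_I_integrand (y eps : R) : 0 < eps ->
  truncated_integral (I_integrand lam phi y) y eps =
  2^-1 * \int[mu]_(t in punctured 0 eps) sym_integrand y t
  - \int[mu]_(x in punctured y eps) (fermi lam x * phi x)
  + \int[mu]_(x in punctured y eps) (oriented_indic y x * phi x).
Proof.
move=> eps0; have mP := @measurable_punctured R y eps.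
rewrite /truncated_integral.
rewrite (@eq_Rintegral _ _ _ mu _ _ _ (@I_integrand_decomp y eps eps0)).
rewrite (RintegralD mP (integrable_decomp y eps0) (i_orient y eps)).
rewrite (RintegralB mP (integrable_singular y eps0) (i_fermi y eps)).
by rewrite Rintegral_singular.
Qed.

(** The value of [I_op] minus the oriented integral, written with absolutely convergent integrals so
    that bounds and continuity involve no principal value. *)
Definition I_error (y : R) : R :=
  2^-1 * \int[mu]_t sym_integrand y t - \int[mu]_x (fermi lam x * phi x).

Lemma cvg_truncated_I_integrand (y : R) :
  truncated_integral (I_integrand lam phi y) y eps @[eps --> 0^'+] -->
  I_error y + oriented_integral 0 y phi.
Proof.
have h : {near 0^'+, (fun eps : R => 2^-1 * \int[mu]_(t in punctured 0 eps) sym_integrand y t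
  - \int[mu]_(x in punctured y eps) (fermi lam x * phi x)
  + \int[mu]_(x in punctured y eps) (oriented_indic y x * phi x)) =1
  truncated_integral (I_integrand lam phi y) y}.
  by near=> eps; rewrite truncated_I_integrand.
apply: cvg_trans (near_eq_cvg h) _.
rewrite -Rintegral_oriented_indic//; apply: cvgD; last first.
  by apply: cvg_Rintegral_punctured; exact: integrable_oriented_indic.
apply: cvgB; last by apply: cvg_Rintegral_punctured; exact: integrable_fermiM.
apply: cvgMr; apply: cvg_Rintegral_punctured; exact: integrable_sym_integrand.
Unshelve. all: by end_near. Qed.

(** Only the symmetrised integral varies with [y]; continuity passes under it by a majorant uniform
    over points within 1 of [y]. *)
Lemma continuous_I_error : continuous I_error.
Proof.
move=> y; apply: cvgB; last exact: cvg_cst.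
apply: cvgMr.
(* If |x - y| <= 1 then 1 + |x| <= 2 + |y|. *)
pose M : R := 2 * N * K / lam * (2 + `|y|) ^+ m.
have M0 : 0 <= M.
  by rewrite !mulr_ge0 ?invr_ge0 ?exprn_ge0 ?addr_ge0 ?(ltW lam0).
apply: (@continuity_under_integral _ _ _ mu sym_integrand setT measurableT (y - 1) (y + 1)
   _ _ (fun t => M * expR (- (2^-1 * `|t|)))).
- by move=> x _; exact: integrable_sym_integrand.
- apply: aeW => t _ x _; apply: cvgMr; apply: cvgB.
    apply: (@continuous_comp _ _ _ (fun z : R => z - t) phi); last exact: cphi.
    by apply: cvgB; [exact: cvg_id|exact: cvg_cst].
  apply: (@continuous_comp _ _ _ (fun z : R => z + t) phi); last exact: cphi.
  by apply: cvgD; [exact: cvg_id|exact: cvg_cst].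
- apply: (@integrable_exp_decay _ 2^-1 M) => //.
    apply: measurable_funM => //.
    apply: measurableT_comp; first exact: measurable_expR.
    by apply: measurable_funN; exact: measurable_funM.
  by move=> t; rewrite ger0_norm// mulr_ge0 ?expR_ge0.
- move=> x; rewrite /= in_itv /= => xy; apply: aeW => t _.
  apply: (le_trans (normr_sym_integrand_le x t)); rewrite ler_wpM2r ?expR_ge0//.
  rewrite ler_wpM2l ?mulr_ge0 ?invr_ge0 ?(ltW lam0)//.
  rewrite lerXn2r ?nnegrE ?addr_ge0//.
  have : `|x - y| <= 1 by rewrite ler_norml; lra.
  by have := ler_normD (x - y) y; rewrite subrK; lra.
- by rewrite inE /= in_itv /=; lra.
Qed.

Lemma normr_I_error_le (y : R) :
  `|I_error y| <= 6 * K / lam * N * (1 + `|y|) ^+ m.+1.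
Proof.
have h1 := @normr_Rintegral_exp_decay _ 2^-1 _ _ ltac:(lra)
  (measurable_sym_integrand y) (normr_sym_integrand_le y).
have h2 := normr_Rintegral_exp_decay lam0 mfermiM normr_fermiM_le.
have y1 : 1 <= 1 + `|y| by rewrite lerDl.
apply: (le_trans (ler_normB _ _)); rewrite normrM (@ger0_norm _ 2^-1)//.
set A := `|_| in h1 *; set B := `|_| in h2 *.
have P0 : 0 <= N * K / lam by rewrite !mulr_ge0 ?invr_ge0 ?(ltW lam0).
(* The 4 is 1/2 times 2 times 4, the last being the integral of e^{-|t|/2}; the Fermi term below
   adds 2, from 2/lam. *)
have e1 : 2^-1 * A <= 4 * (N * K / lam) * (1 + `|y|) ^+ m.
  rewrite (_ : _ * (1 + `|y|) ^+ m = 2^-1 *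
     (2 * N * K / lam * (1 + `|y|) ^+ m * (2 / 2^-1))); last by field; rewrite gt_eqF.
  by rewrite ler_wpM2l.
have e2 : B <= 2 * (N * K / lam) * 1.
  by rewrite (_ : _ * 1 = N * K * (2 / lam)) //; field; rewrite gt_eqF.
(* The bounds have weight exponents m and 0; both are raised to m + 1 using 1 + |y| >= 1. *)
have q1 : (1 + `|y|) ^+ m <= (1 + `|y|) ^+ m.+1 by rewrite ler_weXn2l.
have q2 : 1 <= (1 + `|y|) ^+ m.+1 by exact: exprn_ege1.
rewrite (_ : 6 * K / lam * N * _ = 4 * (N * K / lam) * (1 + `|y|) ^+ m.+1 +
  2 * (N * K / lam) * (1 + `|y|) ^+ m.+1); last by ring.
apply: lerD; first by apply: (le_trans e1); rewrite ler_wpM2l// mulr_ge0.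
by apply: (le_trans e2); rewrite ler_wpM2l// mulr_ge0.
Qed.

End estimate.

(** * Weighted norms and the final estimate *)

Lemma Lambda_bound_norm (R : realType) (k m : nat) (f : R -> R) :
  Lambda k m f -> Lambda_bound k m f (Lambda_norm k m f).
Proof.
move=> [_ fC] l lk x.
have w0 : 0 < (1 + `|x|) ^+ m by rewrite exprn_gt0// ltr_wpDr.
(* The infimum is itself admissible: each ratio of a derivative to the weight bounds all admissible
   constants from below. *)
rewrite -ler_pdivrMr//; apply: lb_le_inf; first exact: fC.
by move=> C /(_ l lk x); rewrite ler_pdivrMr.
Qed.

Lemma Lambda_norm_le (R : realType) (k m : nat) (f : R -> R) (C : R) :
  Lambda_bound k m f C -> Lambda_norm k m f <= C.
Proof.
(* Admissible constants are nonnegative, as seen at [l = 0], [x = 0], where the weight is 1. *)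
move=> fC; apply: ge_inf => //; exists 0 => D /(_ 0 isT 0).
rewrite normr0 addr0 expr1n mulr1; exact: le_trans.
Qed.

Theorem theorem3 (R : realType) (m : nat) :
  exists C : R, forall (lambda : R) (phi : R -> R),
    1 <= lambda -> Lambda 1 m phi ->
    (forall y : R, PV_exists (I_integrand lambda phi y) y) /\
    let g := fun y : R => I_op lambda phi y - oriented_integral 0 y phi in
    Lambda 0 m.+1 g /\
    Lambda_norm 0 m.+1 g <= C * lambda `^ (- (1 / 2)) * Lambda_norm 1 m phi.
Proof.
(* The 6 collects the two error integrals; the other factor is the cost of absorbing the weight. *)
exists (6 * (2 * m.+1%:R) ^+ m) => lam phi lam1 Lphi.
have phiN := Lambda_bound_norm Lphi.
set N := Lambda_norm 1 m phi in phiN *.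
have [[dphi cphi] _] := Lphi.
have {}dphi : forall x : R, derivable phi x 1 by exact: (dphi 0%N isT).
have {}cphi : continuous phi by exact: (cphi 0%N isT).
have dphiN : forall x, `|derive1 phi x| <= N * (1 + `|x|) ^+ m by exact: (phiN 1%N isT).
have {}phiN : forall x, `|phi x| <= N * (1 + `|x|) ^+ m by exact: (phiN 0%N isT).
have cvgI := cvg_truncated_I_integrand lam1 cphi dphi phiN dphiN.
split=> [y|/=].
  split; first by move=> eps; exact: integrable_I_integrand lam1 cphi phiN y eps.
  by apply: cvgP; exact: cvgI.
have -> : (fun y => I_op lam phi y - oriented_integral 0 y phi) = I_error lam phi.
  by apply/funext => y; rewrite /I_op /PV (cvg_lim _ (cvgI y))// addrK.
have bound : Lambda_bound 0 m.+1 (I_error lam phi)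
    (6 * (2 * m.+1%:R) ^+ m / lam * N).
  move=> l; rewrite leqn0 => /eqP -> x /=.
  exact: (normr_I_error_le lam1 cphi dphi phiN dphiN).
split.
  split; last by exists (6 * (2 * m.+1%:R) ^+ m / lam * N).
  split=> l //; rewrite leqn0 => /eqP -> /=.
  exact: (continuous_I_error lam1 cphi dphi phiN dphiN).
apply: (le_trans (Lambda_norm_le bound)).
have N0 : 0 <= N.
  by have := le_trans (normr_ge0 _) (phiN 0); rewrite normr0 addr0 expr1n mulr1.
rewrite ler_wpM2r// ler_wpM2l ?mulr_ge0 ?exprn_ge0 ?mulr_ge0//.
(* The bound obtained is of order 1/lam, which is at most lam^{-1/2} because [1 <= lam]. *)
rewrite -powR_inv1 ?(le_trans ler01)//.
by apply: ler_powR => //; lra.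
Qed.
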